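(* Let $X=\sum_{n=0}^\infty a_nZ_ne_n$ be a random van der Put series. Then $X$ is stationary (i.e. for every $s\in\mathbb{Z}_p$ the random function $X(\cdot+s)$ has the same law as $X$) if and only if $$|a_0|\ge|a_1|\ge|a_p|\ge\dots\ge|a_{p^n}|\ge|a_{p^{n+1}}|\ge\dots$$ and, for all $n\ge0$, $|a_{p^n}|=|a_{p^n+1}|=\dots=|a_{p^{n+1}-1}|$.
   Context: $\mathbb{Q}_p$ is the field of $p$-adic numbers with $p$-adic absolute value $|\cdot|$, and $\mathbb{Z}_p=\{x:|x|\le1\}$. $C(\mathbb{Z}_p,\mathbb{Q}_p)$ is the Banach space of continuous functions $\mathbb{Z}_p\to\mathbb{Q}_p$ with sup norm. Each $x\in\mathbb{Z}_p$ is written uniquely as $x=\sum_{k\ge0}b_kp^k$ with $b_k\in\{0,1,\dots,p-1\}$. For a positive integer $m$, write $m\triangleleft x$ if $m=\sum_{k=0}^{M}b_kp^k$ for some $M\in\mathbb{N}$; by convention $0\triangleleft x$ for all $x$. The van der Put functions are $e_n(x)=1$ if $n\triangleleft x$ and $e_n(x)=0$ otherwise ($n=0,1,2,\dots$). A random van der Put series is $X=\sum_{n=0}^\infty a_nZ_ne_n$, where $(Z_n)_{n\ge0}$ are independent random variables each uniformly distributed (normalised Haar measure) on $\mathbb{Z}_p$ — equivalently independent $\mathbb{Q}_p$-Gaussian variables with essential supremum of $|Z_n|$ equal to $1$ — and $(a_n)\subset\mathbb{Q}_p$ satisfies $|a_n|\to0$; the series converges almost surely in $C(\mathbb{Z}_p,\mathbb{Q}_p)$.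 *)

(* Defs.v *)
From HB Require Import structures.
From mathcomp Require Import all_boot all_order all_algebra.
From mathcomp Require Import all_classical all_reals all_analysis.
Set Implicit Arguments.
Unset Strict Implicit.
Unset Printing Implicit Defensive.
Import Order.TTheory GRing.Theory Num.Theory.
Local Open Scope classical_set_scope.
Local Open Scope ring_scope.

Lemma modz_dvdm (m d e : int) : (d %| e)%Z -> modz (modz m e) d = modz m d.
Proof.
move=> /dvdzP [c ->].
rewrite {2}(divz_eq m (c * d)) mulrA.
by rewrite -[in RHS]modzDml modzMl add0r.
Qed.

Section Padic.
Variable p : nat.

(* Z_p = lim Z/p^k Z : coherent sequences (x_k)_k, x_k = x mod p^k,    *)
(* with representatives x_k in [0, p^k).                               *)
Record Zpadic := MkZp {
  zseq : nat -> int ;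
  zseqP : forall k, zseq k = modz (zseq k.+1) (p ^ k)%N%:Z }.

Definition zmk_seq (f : nat -> int) (k : nat) : int := modz (f k) (p ^ k)%N%:Z.

Lemma zmk_seqP (f : nat -> int) :
  (forall k, modz (f k.+1) (p ^ k)%N%:Z = modz (f k) (p ^ k)%N%:Z) ->
  forall k, zmk_seq f k = modz (zmk_seq f k.+1) (p ^ k)%N%:Z.
Proof.
move=> hf k; rewrite /zmk_seq modz_dvdm ?hf //.
by apply/dvdzP; exists p%:Z; rewrite -PoszM expnS mulnC.
Qed.

Definition zmk (f : nat -> int) hf : Zpadic := MkZp (@zmk_seqP f hf).

Lemma zconst_coh (c : int) :
  forall k, modz ((fun _ : nat => c) k.+1) (p ^ k)%N%:Z
            = modz ((fun _ : nat => c) k) (p ^ k)%N%:Z.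
Proof. by []. Qed.

Definition zconst (c : int) : Zpadic := zmk (@zconst_coh c).

Lemma zadd_coh (x y : Zpadic) :
  forall k, modz ((fun k => zseq x k + zseq y k) k.+1) (p ^ k)%N%:Z
            = modz ((fun k => zseq x k + zseq y k) k) (p ^ k)%N%:Z.
Proof. by move=> k /=; rewrite (zseqP x k) (zseqP y k) modzDm. Qed.

Definition zadd (x y : Zpadic) : Zpadic := zmk (@zadd_coh x y).

Lemma zmul_coh (x y : Zpadic) :
  forall k, modz ((fun k => zseq x k * zseq y k) k.+1) (p ^ k)%N%:Z
            = modz ((fun k => zseq x k * zseq y k) k) (p ^ k)%N%:Z.
Proof. by move=> k /=; rewrite (zseqP x k) (zseqP y k) modzMm. Qed.

Definition zmul (x y : Zpadic) : Zpadic := zmk (@zmul_coh x y).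

Lemma zopp_coh (x : Zpadic) :
  forall k, modz ((fun k => - zseq x k) k.+1) (p ^ k)%N%:Z
            = modz ((fun k => - zseq x k) k) (p ^ k)%N%:Z.
Proof. by move=> k /=; rewrite (zseqP x k) modzNm. Qed.

Definition zopp (x : Zpadic) : Zpadic := zmk (@zopp_coh x).

Definition zeqv (x y : Zpadic) : Prop := forall k, zseq x k = zseq y k.

(* base-p digits: x = sum_k zdigit x k * p^k, zdigit x k in {0,..,p-1} *)
Definition zdigit (x : Zpadic) (k : nat) : nat :=
  `|divz (zseq x k.+1 - zseq x k) (p ^ k)%N%:Z|%N.

Definition zval (x : Zpadic) : nat :=
  match pselect (exists k, (fun k => zseq x k.+1 != 0) k) with
  | left H => ex_minn H
  | right _ => 0%N
  end.

Definition zabs (x : Zpadic) : rat :=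
  if pselect (exists k, zseq x k.+1 != 0) then ((p%:R : rat) ^+ zval x)^-1
  else 0.

(* Q_p = Z_p[1/p]: a pair (m, z) stands for z / p^m; elements of Q_p   *)
(* are the equivalence classes of such pairs.                          *)
Definition zpow (j : nat) : Zpadic := zconst (p ^ j)%N%:Z.

Definition qrel (r s : nat * Zpadic) : Prop :=
  zeqv (zmul (zpow s.1) r.2) (zmul (zpow r.1) s.2).

Definition Qpadic := {C : set (nat * Zpadic) | exists r, C = qrel r}.

Definition qcls (r : nat * Zpadic) : Qpadic := exist _ (qrel r) (ex_intro _ r erefl).

Definition qrepr (x : Qpadic) : nat * Zpadic := projT1 (cid (proj2_sig x)).

Definition Zp_to_Qp (z : Zpadic) : Qpadic := qcls (0%N, z).
Definition qzero : Qpadic := Zp_to_Qp (zconst 0).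
Definition qone : Qpadic := Zp_to_Qp (zconst 1).

Definition qadd (x y : Qpadic) : Qpadic :=
  let r := qrepr x in let s := qrepr y in
  qcls ((r.1 + s.1)%N, zadd (zmul (zpow s.1) r.2) (zmul (zpow r.1) s.2)).

Definition qmul (x y : Qpadic) : Qpadic :=
  let r := qrepr x in let s := qrepr y in
  qcls ((r.1 + s.1)%N, zmul r.2 s.2).

Definition qopp (x : Qpadic) : Qpadic :=
  let r := qrepr x in qcls (r.1, zopp r.2).

Definition qabs (x : Qpadic) : rat :=
  let r := qrepr x in (p%:R : rat) ^+ r.1 * zabs r.2.

Fixpoint qsum (u : nat -> Qpadic) (M : nat) : Qpadic :=
  match M with 0%N => qzero | M'.+1 => qadd (qsum u M') (u M') end.

Definition qseries_to (u : nat -> Qpadic) (L : Qpadic) : Prop :=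
  forall eps : rat, 0 < eps ->
    exists N, forall M, (N <= M)%N -> qabs (qadd (qsum u M) (qopp L)) < eps.

Definition qnull (a : nat -> Qpadic) : Prop :=
  forall eps : rat, 0 < eps -> exists N, forall n, (N <= n)%N -> qabs (a n) < eps.

Definition vdp_le (n : nat) (x : Zpadic) : Prop :=
  n = 0%N \/ exists M : nat, n = (\sum_(k < M.+1) zdigit x k * p ^ k)%N.

Definition vdp (n : nat) (x : Zpadic) : Qpadic :=
  if pselect (vdp_le n x) then qone else qzero.

Definition zball (a : Zpadic) (k : nat) : set Zpadic :=
  [set z | zseq z k = zseq a k].         (* a + p^k Z_p *)

Definition Zp_borel : set (set Zpadic) :=
  <<s [set B | exists a k, B = zball a k] >>.

Definition qball (a : Qpadic) (r : rat) : set Qpadic :=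
  [set y | qabs (qadd y (qopp a)) <= r].

Definition Qp_borel : set (set Qpadic) :=
  <<s [set B | exists a (r : rat), 0 < r /\ B = qball a r] >>.

Section Proba.
Context (R : realType) (d : measure_display) (T : measurableType d)
        (P : probability T R).

Definition Zp_random_variable (Y : T -> Zpadic) : Prop :=
  forall B, Zp_borel B -> measurable (Y @^-1` B).

(* Y is distributed according to the normalised Haar measure of Z_p *)
Definition Zp_uniform (Y : T -> Zpadic) : Prop :=
  forall (a : Zpadic) (k : nat),
    P (Y @^-1` zball a k) = (((p%:R : R) ^+ k)^-1)%:E.

Definition Zp_independent (Y : nat -> T -> Zpadic) : Prop :=
  forall (I : seq nat) (B : nat -> set Zpadic), uniq I ->
    (forall i, Zp_borel (B i)) ->
    P (\bigcap_(i in [set` I]) (Y i @^-1` B i))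
    = (\prod_(i <- I) fine (P (Y i @^-1` B i)))%:E.

Definition same_law (X Y : T -> Zpadic -> Qpadic) : Prop :=
  forall (m : nat) (xs : 'I_m -> Zpadic) (B : 'I_m -> set Qpadic),
    (forall i, Qp_borel (B i)) ->
    P [set w | forall i, B i (X w (xs i))] = P [set w | forall i, B i (Y w (xs i))].

Definition stationary (X : T -> Zpadic -> Qpadic) : Prop :=
  forall s : Zpadic, same_law (fun w x => X w (zadd x s)) X.

End Proba.
End Padic.

(* Main.v *)
Require Import Defs.
From HB Require Import structures.
From mathcomp Require Import all_boot all_order all_algebra.
From mathcomp Require Import all_classical all_reals all_analysis.
From mathcomp Require Import ring zify.
Set Implicit Arguments.
Unset Strict Implicit.
Unset Printing Implicit Defensive.
Import Order.TTheory GRing.Theory Num.Theory.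
Local Open Scope classical_set_scope.
Local Open Scope ring_scope.

(** Fix a scale [m] with every [a_n] in [p^-m Z_p], say [a_n = p^-m A_n], and a
precision [K].  Modulo [p^K] only finitely many [A_j], those with [j < p^n],
survive, and [p^m X] becomes the value at a uniform vector [zeta] of residues of
the linear map sending [zeta] to the function [x |-> sum_j A_j zeta_j e_j(x)] on
[Z/p^n].  A homomorphism of finite groups pushes the uniform law to the uniform
law on its image, so stationarity says exactly that, for all [K], this image is
invariant under translations.  If [|a_j| <= |a_i|] whenever the level of [i] is
at most that of [j], the image is cut out by the conditions
[f(j) - f(j mod p^l) \in A_j Z/p^K] (with [p^l <= j < p^(l+1)]), which are
invariant.  Conversely, comparing images at the pair [(0, c p^k)] and its
translates, with [zeta] a unit vector, gives the divisibilities between the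
[A_j] that amount to the inequalities between absolute values. *)

(** * Fibres of homomorphisms of finite groups *)

Lemma card_fiber_morph (V W : finZmodType) (L : V -> W) (v0 : V) :
  {morph L : x y / x + y} ->
  #|[pred v | L v == L v0]| = #|[pred v | L v == 0]|.
Proof.
move=> LD.
have inj : injective (fun v => v - v0) by move=> x y /addIr.
rewrite -(fintype.card_image inj [pred v | L v == L v0]).
apply: eq_card => v; rewrite !inE; apply/fintype.imageP/eqP => [[u]|Lv].
  by rewrite inE => /eqP Lu ->; apply: (addIr (L v0)); rewrite -LD addrNK Lu add0r.
by exists (v + v0); rewrite ?addrK// inE LD Lv add0r.
Qed.

(** Every nonempty fibre of a homomorphism is a coset of its kernel, and [|V|] is the size of the
    image times that of the kernel. Equal images thus force kernels of equal size, hence equal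
    fibres over each point. *)
Lemma card_preim_morph (V W : finZmodType) (L L' : V -> W) :
  {morph L : x y / x + y} -> {morph L' : x y / x + y} ->
  (forall v, exists v', L' v' = L v) -> (forall v, exists v', L v' = L' v) ->
  forall F : pred W, #|[pred v | F (L v)]| = #|[pred v | F (L' v)]|.
Proof.
move=> LD L'D im im'.
have fib (K : V -> W) : {morph K : x y / x + y} -> forall w,
    #|[pred v | K v == w]| = ((w \in codom K) * #|[pred v | K v == 0%R]|)%N.
  move=> KD w; have [/codomP[v0 ->]|wK] := boolP (w \in codom K).
    by rewrite mul1n; exact: card_fiber_morph.
  by apply: eq_card0 => v; rewrite !inE; apply: contraNF wK => /eqP<-; exact: codom_f.
have cnt (K : V -> W) (G : pred W) : #|[pred v | G (K v)]| =
    (\sum_(w | G w) #|[pred v | K v == w]|)%N.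
  rewrite -sum1_card (partition_big K G)//=; apply: eq_bigr => w Gw.
  rewrite -sum1_card; apply: eq_bigl => v /=; rewrite !inE.
  by have [->|_] := eqVneq (K v) w; rewrite ?andbF // andbT.
have codomE : codom L =i codom L'.
  move=> w; apply/codomP/codomP => -[v ->].
    by have [v' <-] := im v; exists v'.
  by have [v' <-] := im' v; exists v'.
have cardV (K : V -> W) : {morph K : x y / x + y} ->
    #|V| = (#|codom K| * #|[pred v | K v == 0%R]|)%N.
  move=> KD; have -> : #|V| = #|[pred v : V | predT (K v)]| by exact: eq_card.
  rewrite cnt (eq_bigr _ (fun w _ => fib K KD w)) -big_distrl/=.
  by rewrite -[#|codom K|]sum1_card [in RHS]big_mkcond.
have ker : #|[pred v | L v == 0]| = #|[pred v | L' v == 0]|.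
  apply/eqP; rewrite -(@eqn_pmul2l #|codom L|); last first.
    by apply/card_gt0P; exists (L 0); exact: codom_f.
  by rewrite -cardV// (eq_card codomE) -cardV.
by move=> F; rewrite (cnt L) (cnt L'); apply: eq_bigr => w _;
  rewrite (fib L LD) (fib L' L'D) ker codomE.
Qed.

(** * Van der Put sums over a finite ring *)

(** The relation $j\triangleleft x$ with the truncation point fixed at the leading digit of [j]. The
    case [j = 0] is split off because [trunc_log p 0 = 0] would impose [x %% p == 0]. *)
Definition vdp_nat (p j x : nat) : bool :=
  (j == 0)%N || (x %% p ^ (trunc_log p j).+1 == j)%N.

Definition vdp_sum (p N : nat) (A : comPzRingType) (al ze : nat -> A) (x : nat) : A :=
  \sum_(j < N | vdp_nat p j x) al j * ze j.

Section VdpNat.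
Variable p : nat.
Hypothesis p_gt1 : (1 < p)%N.
Local Notation lv := (trunc_log p).
Local Notation e := (vdp_nat p).

Let p_gt0 : (0 < p)%N. Proof. exact: ltnW. Qed.

Lemma lt_exp_level j : (j < p ^ (lv j).+1)%N.
Proof. exact: trunc_log_ltn. Qed.

Lemma le_exp_level j : (0 < j)%N -> (p ^ lv j <= j)%N.
Proof. by move=> j0; have /andP[] := trunc_log_bounds p_gt1 j0. Qed.

Lemma level_lt j k : (j < p ^ k)%N -> (0 < k)%N -> (lv j < k)%N.
Proof.
move=> jk k0; have [->|j0] := posnP j; first by rewrite trunc_log0.
by rewrite -(ltn_exp2l _ _ p_gt1); apply: leq_ltn_trans jk; exact: le_exp_level.
Qed.

Lemma vdp_nat_self j : e j j.
Proof. by rewrite /vdp_nat modn_small ?eqxx ?orbT ?lt_exp_level. Qed.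

Lemma vdp_nat_le j x : e j x -> (j <= x)%N.
Proof. by case/orP => /eqP => [->//|{1}<-]; exact: leq_mod. Qed.

Lemma vdp_nat_mod k j x y : (j < p ^ k)%N -> x = y %[mod p ^ k] -> e j x = e j y.
Proof.
move=> jk xy; have [->//|j0] := posnP j; rewrite /vdp_nat; congr (_ || (_ == _)).
have lk : (lv j < k)%N.
  by apply: level_lt => //; case: k jk {xy} => //; rewrite expn0 ltnS leqNgt j0.
by rewrite -(modn_dvdm x (dvdn_exp2l p lk)) xy modn_dvdm// dvdn_exp2l.
Qed.

(** Below [p ^ lv x], only [x] modulo that power is seen. From there on, [e j x] forces [j <= x], so
    [j] has the level of [x] and must be [x] itself. *)
Lemma vdp_nat_trunc j x : (0 < x)%N -> e j x = (j == x) || e j (x %% p ^ lv x).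
Proof.
move=> x0; have [->|j0] := posnP j; first by rewrite /vdp_nat eqxx orbT.
have il : (x %% p ^ lv x < p ^ lv x)%N by rewrite ltn_mod expn_gt0 p_gt0.
have [jl|lj] := ltnP j (p ^ lv x).
  rewrite (@vdp_nat_mod (lv x) _ x (x %% p ^ lv x)%N) ?modn_mod//.
  by rewrite (ltn_eqF (leq_trans jl (le_exp_level x0))).
rewrite [X in _ || X](introF idP) ?orbF; last first.
  by move=> /vdp_nat_le ji; have := leq_trans lj ji; rewrite leqNgt il.
have [->|jx] := eqVneq j x; first exact: vdp_nat_self.
apply/negP => ejx; have jlx := vdp_nat_le ejx.
have ljx : lv j = lv x.
  apply: trunc_log_eq => //; rewrite lj /=.
  exact: leq_ltn_trans jlx (lt_exp_level x).
move: ejx; rewrite /vdp_nat ljx modn_small ?lt_exp_level// => /orP[]/eqP E.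
  by rewrite E in j0.
by rewrite E eqxx in jx.
Qed.

(** * Sufficiency at finite level: divisibility gives translation invariance *)

Section Sum.
Variables (n : nat) (A : comPzRingType) (al : nat -> A).
Local Notation N := (p ^ n)%N.
Local Notation S := (vdp_sum p N al).

Lemma vdp_sum_mod ze x y : x = y %[mod N] -> S ze x = S ze y.
Proof.
by move=> xy; rewrite /vdp_sum; apply: eq_bigl => j; exact: (vdp_nat_mod (ltn_ord j) xy).
Qed.

Lemma vdp_sum0 ze : S ze 0%N = al 0%N * ze 0%N.
Proof.
have N0 : (0 < N)%N by rewrite expn_gt0 p_gt0.
rewrite /vdp_sum (bigD1 (Ordinal N0))//= big1 ?addr0// => j /andP[/vdp_nat_le].
by rewrite leqn0 => /eqP j0 /eqP[]; exact: val_inj.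
Qed.

(** The triangular structure: passing from [x] to [x] without its leading digit loses exactly the
    term of index [x]. *)
Lemma vdp_sum_trunc ze x : (0 < x)%N -> (x < N)%N ->
  S ze x = S ze (x %% p ^ lv x)%N + al x * ze x.
Proof.
move=> x0 xN; rewrite /vdp_sum (bigD1 (Ordinal xN))/= ?vdp_nat_self// addrC.
congr (_ + _); apply: eq_bigl => j; rewrite (vdp_nat_trunc j x0).
rewrite -val_eqE/=; have [jx|] := eqVneq (val j) x; rewrite ?andbF ?andbT//=.
apply/esym/negP => /vdp_nat_le; rewrite jx leqNgt => /negP; apply.
apply: leq_trans (le_exp_level x0).
by rewrite ltn_mod expn_gt0 p_gt0.
Qed.

(** The form taken over a finite quotient by $|a_j|\le|a_i|$ for [j] of level at least that of
    [i]. *)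
Hypothesis dvd_al : forall i j, (i < N)%N -> (p ^ lv i <= j < N)%N ->
  exists c, al j = c * al i.

(** Terms of index below [p ^ lv i] cancel in the difference; all others are multiples of [al i]. *)
Lemma vdp_sum_dvd i ze x y : (i < N)%N -> x = y %[mod p ^ lv i] ->
  exists c, S ze x - S ze y = al i * c.
Proof.
move=> iN xy; rewrite /vdp_sum !(big_mkcond (fun j : 'I_N => e j _))/= -sumrB.
apply: (big_ind (fun t => exists c, t = al i * c)) => [|a b [c ->] [d ->]|j _].
- by exists 0; rewrite mulr0.
- by exists (c + d); rewrite mulrDr.
have [ji|ij] := ltnP j (p ^ lv i).
  by exists 0; rewrite mulr0 (vdp_nat_mod ji xy) subrr.
have [|c alj] := @dvd_al i j iN; first by rewrite ij/=.
rewrite alj; case: (e j x); case: (e j y); rewrite ?subrr ?subr0 ?sub0r.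
- by exists 0; rewrite mulr0.
- by exists (c * ze j); rewrite mulrA (mulrC c).
- by exists (- (c * ze j)); rewrite mulrN mulrA (mulrC c).
- by exists 0; rewrite mulr0.
Qed.

(** The new coefficient at [j] is a quotient by [al j] of the increment of the translated function
    [f] from [j %% p ^ lv j] to [j], or of [f 0] when [j = 0]. Translation preserves congruences, so
    [vdp_sum_dvd] makes each increment divisible. *)
Lemma vdp_sum_shift ze s : exists ze', forall x, S ze' x = S ze (x + s)%N.
Proof.
have N0 : (0 < N)%N by rewrite expn_gt0 p_gt0.
pose f x := S ze (x + s)%N.
have ex (j : 'I_N) : exists z, al j * z =
    f j - (if j == 0%N :> nat then 0 else f (j %% p ^ lv j)%N).
  have [j0|j0] := eqVneq (j : nat) 0%N.
    rewrite subr0 /f /vdp_sum j0.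
    apply: (big_ind (fun t => exists z, al 0%N * z = t)) => [|a b [c <-] [d <-]|k _].
    - by exists 0; rewrite mulr0.
    - by exists (c + d); rewrite mulrDr.
    have [k0|k0] := eqVneq (k : nat) 0%N; first by rewrite k0; exists (ze 0%N).
    have [|c ->] := @dvd_al 0 k N0; first by rewrite trunc_log0 expn0 ltn_ord lt0n k0.
    by exists (c * ze k); rewrite mulrA (mulrC c).
  have [|c ->] := @vdp_sum_dvd j ze (j + s) (j %% p ^ lv j + s) (ltn_ord j).
    by rewrite modnDml.
  by exists c.
have [z zP] := fin_all_exists ex.
exists (fun j => oapp (z : 'I_N -> A) 0 (insub j)) => x.
(* Both sides have period [p ^ n], so [x < p ^ n] may be assumed; the induction then removes leading
   digits. *)
rewrite (@vdp_sum_mod _ x (x %% N)%N) ?modn_mod//.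
rewrite (@vdp_sum_mod _ (x + s)%N (x %% N + s)%N) ?modnDml//.
have: (x %% N < N)%N by rewrite ltn_mod.
move: (x %% N)%N => {}x.
elim/ltn_ind: x => x IH xN; have [->|x0] := posnP x.
  rewrite vdp_sum0 /= (insubT (fun i => i < N)%N N0) /=; have := zP (Ordinal N0).
  by rewrite /= subr0 /f => ->.
have xl : (x %% p ^ lv x < x)%N.
  apply: leq_trans (le_exp_level x0); by rewrite ltn_mod expn_gt0 p_gt0.
rewrite (vdp_sum_trunc _ x0 xN) (IH _ xl (ltn_trans xl xN)) /=.
rewrite (insubT (fun i => i < N)%N xN)/=.
have := zP (Ordinal xN); rewrite /= gtn_eqF// => ->.
by rewrite /f addrC subrK.
Qed.

End Sum.

(** * Necessity at finite level: translation invariance gives divisibility *)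

Section Necessity.
Variables (n : nat) (A : comPzRingType) (al : nat -> A).
Local Notation N := (p ^ n)%N.
Local Notation S := (vdp_sum p N al).

Lemma vdp_sum_delta j x : (j < N)%N ->
  S (fun k => (k == j)%:R) x = al j * (e j x)%:R.
Proof.
move=> jN; rewrite /vdp_sum big_mkcond (bigD1 (Ordinal jN))//= eqxx mulr1.
rewrite big1 ?addr0; first by case: ifP; rewrite ?mulr1 ?mulr0.
by move=> k; rewrite -val_eqE /= => /negbTE ->; rewrite mulr0 if_same.
Qed.

(** Equality of the images at a pair of points and at the translated pair, as two inclusions. *)
Hypothesis shift_pair : forall x y s ze,
  (exists ze', S ze' x = S ze (x + s)%N /\ S ze' y = S ze (y + s)%N) /\
  (exists ze', S ze' (x + s)%N = S ze x /\ S ze' (y + s)%N = S ze y).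

Lemma shift_dvd_al01 : (1 < N)%N -> exists u, al 1%N = al 0%N * u.
Proof.
move=> N1; have [[ze [+ _]] _] := shift_pair 0 0 1 (fun k => (k == 1%N)%:R).
rewrite vdp_sum0 add0n vdp_sum_delta// vdp_nat_self mulr1 => <-.
by exists (ze 0%N).
Qed.

(** Let [t] be the leading-digit part of [i]. The unit vector at [j] changes by [al j], up to sign,
    between [s] and [s + t]. The same change must be attained between [i %% p ^ k] and [i], where
    every increment is a multiple of [al i]. *)
Lemma shift_dvd_al k j s i : (p ^ k <= i < p ^ k.+1)%N -> (i < N)%N -> (j < N)%N ->
  e j s != e j (s + (i - i %% p ^ k))%N -> exists u, al j = al i * u.
Proof.
move=> /andP[ki ik] iN jN ejs; set t := (i - i %% p ^ k)%N.
have i0 : (0 < i)%N by apply: leq_trans ki; rewrite expn_gt0 p_gt0.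
have li : lv i = k by apply: trunc_log_eq => //; rewrite ki ik.
have ti : (t + i %% p ^ k = i)%N by rewrite subnK// leq_mod.
(* The values at [(s, s + t)] are carried first to [(0, t)], then to [(i %% p ^ k, i)]. *)
have [[ze1 [E0 Et]] _] := shift_pair 0 t s (fun k => (k == j)%:R).
have [_ [ze2 []]] := shift_pair 0 t (i %% p ^ k)%N ze1.
rewrite E0 Et ti add0n !vdp_sum_delta// (vdp_sum_trunc _ _ i0 iN) li => -> /esym.
move: ejs; rewrite -/t addnC; case: (e j s); case: (e j _) => //= _.
  by rewrite mulr0 mulr1 => /esym/eqP; rewrite addrC addr_eq0 => /eqP E;
    exists (- ze2 i); rewrite mulrN E opprK.
by rewrite mulr0 mulr1 add0r => ->; exists (ze2 i).
Qed.

(** The function $e_j$ vanishes at [j - p ^ k], which is smaller than [j], and equals one at [j]. *)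
Lemma shift_dvd_al_up k j : (p ^ k <= j < N)%N -> exists u, al j = al (p ^ k)%N * u.
Proof.
move=> /andP[kj jN]; have pk0 : (0 < p ^ k)%N by rewrite expn_gt0 p_gt0.
apply: (@shift_dvd_al k j (j - p ^ k)%N) => //.
- by rewrite leqnn ltn_exp2l//=.
- exact: leq_ltn_trans jN.
rewrite modnn subn0 subnK// vdp_nat_self.
case: (boolP (e j _)) => // /vdp_nat_le; rewrite leqNgt ltn_subrL pk0.
by rewrite (leq_trans pk0 kj).
Qed.

(** The function of index [p ^ k] equals one at [p ^ k], and zero after adding the leading part [t]
    of [i], because [0 < t < p ^ k.+1]. *)
Lemma shift_dvd_al_down k i : (p ^ k <= i < p ^ k.+1)%N -> (i < N)%N ->
  exists u, al (p ^ k)%N = al i * u.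
Proof.
move=> /[dup] kik /andP[ki ik] iN; have pk0 : (0 < p ^ k)%N by rewrite expn_gt0 p_gt0.
apply: (@shift_dvd_al k (p ^ k)%N (p ^ k)%N i kik iN); first exact: leq_ltn_trans iN.
rewrite vdp_nat_self eq_sym; set t := (i - _)%N.
have t0 : (0 < t)%N by rewrite subn_gt0; apply: leq_trans ki; rewrite ltn_mod.
have tk : (t < p ^ k.+1)%N by apply: leq_ltn_trans ik; rewrite leq_subr.
suff /negbTE-> : ~~ e (p ^ k)%N (p ^ k + t)%N by [].
rewrite /vdp_nat gtn_eqF//= trunc_expnK//.
rewrite -[X in _ != X](@modn_small _ (p ^ k.+1)) ?ltn_exp2l//.
by rewrite -[X in _ != (X %% _)%N]addn0 eqn_modDl mod0n modn_small// -lt0n.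
Qed.

End Necessity.
End VdpNat.

(** * The ring [Z_p] *)

Lemma intr_Zp_eq0 (q : nat) (a : int) : (1 < q)%N ->
  (a%:~R == 0 :> 'Z_q) = (q%:Z %| a)%Z.
Proof.
move=> q1; rewrite dvdzE; case: a => a; rewrite ?NegzE ?mulrNz ?oppr_eq0 ?abszN /=.
  by rewrite -val_eqE /= (val_Zp_nat q1).
by rewrite -val_eqE /= (val_Zp_nat q1).
Qed.

Lemma eq_intr_Zp (q : nat) (a b : int) : (1 < q)%N ->
  (a%:~R == b%:~R :> 'Z_q) = (modz a q == modz b q).
Proof. by move=> q1; rewrite -subr_eq0 -rmorphB/= intr_Zp_eq0// eqz_mod_dvd. Qed.

(** The gcd of [a] and [p ^ K] is a power of [p], so it divides [b]; by Bezout it is a multiple of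
    [a] modulo [p ^ K]. *)
Lemma intr_Zp_dvd (p K : nat) (a b : int) : prime p -> (0 < K)%N ->
  (forall k, (k <= K)%N -> ((p ^ k)%N%:Z %| a)%Z -> ((p ^ k)%N%:Z %| b)%Z) ->
  exists c : 'Z_(p ^ K), b%:~R = c * a%:~R.
Proof.
move=> pp K0 ab; set q := (p ^ K)%N.
have q1 : (1 < q)%N by rewrite -(expn0 p) ltn_exp2l ?prime_gt1.
have [k kK gk] : exists2 k, (k <= K)%N & gcdz a q%:Z = (p ^ k)%N%:Z.
  have : (gcdn `|a| q %| q)%N by exact: dvdn_gcdr.
  by move=> /(dvdn_pfactor _ _ pp)[k kK E]; exists k => //; rewrite /gcdz absz_nat E.
have /dvdzP[c bc] : (gcdz a q%:Z %| b)%Z.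
  by rewrite gk ab// -gk dvdz_gcdl.
have [u [v uv]] := Bezoutz a q%:Z.
exists (c * u)%:~R; rewrite bc -uv !rmorphM/= rmorphD/= !rmorphM/=.
rewrite [X in _ + _ * X](_ : _ = 0) ?mulr0 ?addr0 ?mulrA//.
by apply/eqP; rewrite intr_Zp_eq0.
Qed.

Section PadicBasics.
Variable p : nat.
Hypothesis p_gt1 : (1 < p)%N.
Local Notation Zp := (Zpadic p).
Local Notation Qp := (Qpadic p).

Let p_gt0 : (0 < p)%N. Proof. exact: ltnW. Qed.

Let pX_gt0 k : (0 < p ^ k)%N. Proof. by rewrite expn_gt0 p_gt0. Qed.

Lemma zeqv_eq (x y : Zp) : zeqv x y -> x = y.
Proof.
case: x y => [x xP] [y yP] /= xy.
have {}xy : x = y by apply: funext => k; exact: xy.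
by rewrite xy in xP *; congr MkZp; exact: Prop_irrelevance.
Qed.

Lemma zseq_ge0 (x : Zp) k : 0 <= zseq x k.
Proof. by rewrite zseqP modz_ge0// eqz_nat -lt0n. Qed.

Lemma zseq_lt (x : Zp) k : zseq x k < (p ^ k)%N%:Z.
Proof. by rewrite zseqP ltz_pmod// ltz_nat. Qed.

Lemma zseq_modn (x : Zp) k n : (k <= n)%N -> modz (zseq x n) (p ^ k)%N%:Z = zseq x k.
Proof.
elim: n => [|n IH]; first by rewrite leqn0 => /eqP->; rewrite modz_small// zseq_ge0 zseq_lt.
rewrite leq_eqVlt => /predU1P[->|]; first by rewrite modz_small// zseq_ge0 zseq_lt.
rewrite ltnS => kn; rewrite -(IH kn) [zseq x n]zseqP modz_dvdm//.
by rewrite dvdzE !absz_nat dvdn_exp2l.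
Qed.

Lemma zseq_mod (x : Zp) k : modz (zseq x k) (p ^ k)%N%:Z = zseq x k.
Proof. exact: zseq_modn. Qed.

Lemma zseq0 (x : Zp) : zseq x 0 = 0.
Proof. by rewrite -zseq_mod expn0 modz1. Qed.

Lemma zseq_eq_le (x y : Zp) j k : (j <= k)%N -> zseq x k = zseq y k -> zseq x j = zseq y j.
Proof. by move=> jk xy; rewrite -(zseq_modn x jk) xy zseq_modn. Qed.

Lemma zseq_zconst0 k : zseq (zconst p 0) k = 0.
Proof. exact: mod0z. Qed.

Lemma zseq_eq0_le (x : Zp) j k : (j <= k)%N -> zseq x k = 0 -> zseq x j = 0.
Proof.
by move=> jk xk; rewrite -(zseq_zconst0 j); apply: zseq_eq_le jk _; rewrite xk zseq_zconst0.
Qed.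

Lemma zseq_dvd (x : Zp) k n : (k <= n)%N -> ((p ^ k)%N%:Z %| zseq x n)%Z = (zseq x k == 0).
Proof. by move=> kn; rewrite -(zseq_modn x kn); apply/dvdz_mod0P/eqP. Qed.

Lemma zseq_zadd (x y : Zp) k : zseq (zadd x y) k = modz (zseq x k + zseq y k) (p ^ k)%N%:Z.
Proof. by []. Qed.

Lemma zseq_zmul (x y : Zp) k : zseq (zmul x y) k = modz (zseq x k * zseq y k) (p ^ k)%N%:Z.
Proof. by []. Qed.

Lemma zseq_zopp (x : Zp) k : zseq (zopp x) k = modz (- zseq x k) (p ^ k)%N%:Z.
Proof. by []. Qed.

Lemma zseq_zpow j k : zseq (zpow p j) k = modz (p ^ j)%N%:Z (p ^ k)%N%:Z.
Proof. by []. Qed.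

Definition zseqE := (zseq_zadd, zseq_zmul, zseq_zopp, zseq_zpow).
Definition modzE := (modzDml, modzDmr, modzMml, modzMmr, modzNm).

Lemma zseq_zpow_mul j (x : Zp) k :
  zseq (zmul (zpow p j) x) (j + k) = (p ^ j)%N%:Z * zseq x k.
Proof.
rewrite !zseqE !modzE -(zseq_modn x (leq_addl j k)) expnD PoszM.
by rewrite mulz_modr ?ltz_nat.
Qed.

Lemma zpow_mul_inj j (x y : Zp) : zmul (zpow p j) x = zmul (zpow p j) y -> x = y.
Proof.
move=> xy; apply: zeqv_eq => k.
have : zseq (zmul (zpow p j) x) (j + k) = zseq (zmul (zpow p j) y) (j + k) by rewrite xy.
rewrite !zseq_zpow_mul.
by apply: mulfI; rewrite eqz_nat -lt0n.
Qed.

(** Division by [p ^ j] costs [j] digits of precision: the quotient modulo [p ^ k] is read from [x]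
    modulo [p ^ (j + k)]. *)
Lemma zpow_dvd j (x : Zp) : zseq x j = 0 -> exists y, x = zmul (zpow p j) y.
Proof.
move=> xj; have dv k : ((p ^ j)%N%:Z %| zseq x (j + k))%Z.
  by rewrite zseq_dvd ?leq_addr// xj.
have pj0 : (p ^ j)%N%:Z != 0 by rewrite eqz_nat -lt0n.
have hf k : divz (zseq x (j + k)) (p ^ j)%N%:Z =
    modz (divz (zseq x (j + k.+1)) (p ^ j)%N%:Z) (p ^ k)%N%:Z.
  apply: (mulfI pj0); rewrite mulz_modr ?ltz_nat// -PoszM -expnD.
  by rewrite ![_%:Z * divz _ _]mulrC !divzK// zseq_modn// addnS.
exists (MkZp hf); apply: zeqv_eq => k.
apply: (@zseq_eq_le _ _ k (j + k)); first exact: leq_addl.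
by rewrite zseq_zpow_mul /= mulrC divzK.
Qed.

(** The residue modulo [p ^ 0] is always zero, so valuation [v] is first detected at index
    [v.+1]. *)
Lemma zabs_eqX (x : Zp) v : zseq x v = 0 -> zseq x v.+1 != 0 ->
  zabs x = (p%:R ^+ v)^-1.
Proof.
move=> xv xv1; rewrite /zabs /zval.
have ex : exists k, zseq x k.+1 != 0 by exists v.
case: pselect => // H; congr (_ ^+ _)^-1.
case: ex_minnP => m xm mmin; apply/eqP; rewrite eqn_leq mmin// leqNgt.
by apply: contra xm => vm; apply/eqP; exact: zseq_eq0_le vm xv.
Qed.

Lemma zabs_eq0 (x : Zp) : (forall k, zseq x k = 0) -> zabs x = 0.
Proof. by move=> x0; rewrite /zabs; case: pselect => // H; exfalso; case: H => k; rewrite x0. Qed.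

Variant zabs_spec (x : Zp) : rat -> Prop :=
  | ZabsZero of (forall k, zseq x k = 0) : zabs_spec x 0
  | ZabsPow v of zseq x v = 0 & zseq x v.+1 != 0 : zabs_spec x (p%:R ^+ v)^-1.

Lemma zabsP (x : Zp) : zabs_spec x (zabs x).
Proof.
have [x0|] := pselect (forall k, zseq x k = 0).
  by rewrite zabs_eq0//; constructor.
move=> /existsNP[k0 /eqP xk0].
have ex : exists k, zseq x k.+1 != 0.
  by case: k0 xk0 => [|k] xk0; [rewrite zseq0 in xk0 | exists k].
have xm : zseq x (ex_minn ex) = 0.
  case: ex_minnP => -[|m] _ mmin; first by rewrite zseq0.
  by apply/eqP/negPn/negP => /mmin; rewrite ltnn.
have xm1 : zseq x (ex_minn ex).+1 != 0 by case: ex_minnP.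
by rewrite (zabs_eqX xm xm1); constructor.
Qed.

Let pr_gt0 : 0 < p%:R :> rat. Proof. by rewrite ltr0n. Qed.
Let pr_gt1 : 1 < p%:R :> rat. Proof. by rewrite ltr1n. Qed.
Let prX_gt0 k : 0 < p%:R ^+ k :> rat. Proof. exact: exprn_gt0. Qed.

Lemma zabs_le (x : Zp) k : (zabs x <= (p%:R ^+ k)^-1) = (zseq x k == 0).
Proof.
case: zabsP => [x0|v xv xv1]; first by rewrite x0 eqxx invr_ge0 ltW.
rewrite lef_pV2 ?posrE// ler_eXn2l//.
have [kv|vk] := leqP k v; first by rewrite (zseq_eq0_le kv)// eqxx.
by apply/esym/negbTE; apply: contra xv1 => /eqP xk; rewrite (zseq_eq0_le vk).
Qed.

Lemma zabs_le_zabs (x y : Zp) :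
  zabs x <= zabs y <-> (forall k, zseq y k = 0 -> zseq x k = 0).
Proof.
split=> [xy k yk|].
  by apply/eqP; rewrite -zabs_le (le_trans xy)// zabs_le yk.
case: (zabsP y) => [y0|v yv _] yx; last by rewrite zabs_le yx.
by rewrite zabs_eq0// => k; exact: yx.
Qed.

Lemma zabs_zpow_mul j (x : Zp) : zabs (zmul (zpow p j) x) = (p%:R ^+ j)^-1 * zabs x.
Proof.
have pj0 : (p ^ j)%N%:Z != 0 by rewrite eqz_nat -lt0n.
case: (zabsP x) => [x0|v xv xv1].
  rewrite mulr0 zabs_eq0// => k; apply: (@zseq_eq0_le _ k (j + k)); rewrite ?leq_addl//.
  by rewrite zseq_zpow_mul x0 mulr0.
rewrite -invfM -exprD; apply: zabs_eqX.
  by rewrite zseq_zpow_mul xv mulr0.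
by rewrite -addnS zseq_zpow_mul mulf_neq0.
Qed.

(** The absolute value is discrete: any radius can be rounded down to the largest $p^{-k}$,
    [k >= 0], that it bounds. *)
Lemma zabs_le_ball (rho : rat) : 0 < rho ->
  exists k, forall x : Zp, (zabs x <= rho) = (zseq x k == 0).
Proof.
move=> rho0; have ex : exists k, (p%:R ^+ k)^-1 <= rho.
  exists (Num.bound rho^-1); rewrite invf_ple ?posrE//.
  apply: (le_trans (ltW (archi_boundP _))); first by rewrite invr_ge0 ltW.
  by rewrite -natrX ler_nat ltnW// ltn_expl.
exists (ex_minn ex) => x; case: ex_minnP => k krho kmin.
apply/idP/idP; last by rewrite -zabs_le => /le_trans; exact.
rewrite -zabs_le; case: zabsP => [x0|v _ _]; first by rewrite invr_ge0 ltW.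
by move=> /kmin kv; rewrite lef_pV2 ?posrE// ler_eXn2l.
Qed.

(** * The field [Q_p] *)

Lemma qrel_refl (r : nat * Zp) : qrel r r.
Proof. by []. Qed.

Lemma qrel_sym (r s : nat * Zp) : qrel r s -> qrel s r.
Proof. by move=> rs k; rewrite rs. Qed.

Lemma zpow_mulA i j (x : Zp) :
  zmul (zpow p i) (zmul (zpow p j) x) = zmul (zpow p (i + j)) x.
Proof.
by apply: zeqv_eq => k; rewrite !zseqE !modzMml modzMmr expnD PoszM mulrA.
Qed.

(** Multiplying the wanted equation by the middle denominator makes it follow from the other two;
    powers of [p] cancel in $\mathbb{Z}_p$. *)
Lemma qrel_trans (r s t : nat * Zp) : qrel r s -> qrel s t -> qrel r t.
Proof.
move=> /zeqv_eq rs /zeqv_eq st.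
suff E : zmul (zpow p t.1) r.2 = zmul (zpow p r.1) t.2 by rewrite /qrel E.
apply: (@zpow_mul_inj s.1); rewrite zpow_mulA addnC -zpow_mulA rs.
by rewrite zpow_mulA addnC -zpow_mulA st !zpow_mulA addnC.
Qed.

Lemma qcls_eq (r s : nat * Zp) : qrel r s -> qcls r = qcls s.
Proof.
move=> rs; have E : qrel r = qrel s :> set (nat * Zp).
  apply: funext => t; apply: propext; split=> [rt|st].
    exact: qrel_trans (qrel_sym rs) rt.
  exact: qrel_trans rs st.
exact: eq_exist.
Qed.

Lemma qrepr_cls (x : Qp) : qcls (qrepr x) = x.
Proof.
by case: x => C H; rewrite /qrepr; case: cid => r /= E; exact: eq_exist.
Qed.

Lemma qrel_repr (r : nat * Zp) : qrel (qrepr (qcls r)) r.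
Proof.
have := congr1 (@proj1_sig _ _) (qrepr_cls (qcls r)) => /= E.
by apply: qrel_sym; rewrite -E; exact: qrel_refl.
Qed.

Lemma qabs_cls m (x : Zp) : qabs (qcls (m, x)) = p%:R ^+ m * zabs x.
Proof.
rewrite /qabs; have := qrel_repr (m, x); case: (qrepr _) => n y /= /zeqv_eq /= E.
have /(congr1 (@zabs p)) := E; rewrite !zabs_zpow_mul => /(congr1 ( *%R (p%:R ^+ n * p%:R ^+ m))).
have hm := lt0r_neq0 (prX_gt0 m); have hn := lt0r_neq0 (prX_gt0 n).
by rewrite -!mulrA mulVKf// [in RHS](mulrCA _ _^-1) mulVKf.
Qed.

Lemma qabs_cls_le m (x : Zp) k :
  (qabs (qcls (m, x)) <= p%:R ^+ m * (p%:R ^+ k)^-1) = (zseq x k == 0).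
Proof. by rewrite qabs_cls ler_pM2l// zabs_le. Qed.

Lemma qabs_cls_le_cls m (x y : Zp) : qabs (qcls (m, x)) <= qabs (qcls (m, y)) <->
  (forall k, zseq y k = 0 -> zseq x k = 0).
Proof. by rewrite !qabs_cls ler_pM2l// zabs_le_zabs. Qed.

Lemma qcls_zpow m n (x : Zp) : qcls ((m + n)%N, zmul (zpow p n) x) = qcls (m, x).
Proof.
by apply: qcls_eq; rewrite /qrel /= zpow_mulA.
Qed.

Lemma qrel_zadd m (x y : Zp) r s : qrel r (m, x) -> qrel s (m, y) ->
  qrel ((r.1 + s.1)%N, zadd (zmul (zpow p s.1) r.2) (zmul (zpow p r.1) s.2)) (m, zadd x y).
Proof.
case: r s => [a r] [b s]; rewrite /qrel /= => rx sy k.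
have /eqP := rx k; have /eqP := sy k; rewrite !zseqE !modzMml !modzDm !modzMmr !eqz_mod_dvd.
move=> E1 E2; apply/eqP; rewrite eqz_mod_dvd !expnD !PoszM.
rewrite [X in X \in _](_ : _ = (p ^ b)%N%:Z * ((p ^ m)%N%:Z * zseq r k - (p ^ a)%N%:Z * zseq x k)
  + (p ^ a)%N%:Z * ((p ^ m)%N%:Z * zseq s k - (p ^ b)%N%:Z * zseq y k)); last by ring.
by rewrite rpredD// dvdz_mull.
Qed.

Lemma qadd_cls m (x y : Zp) : qadd (qcls (m, x)) (qcls (m, y)) = qcls (m, zadd x y).
Proof. by apply: qcls_eq; apply: qrel_zadd; exact: qrel_repr. Qed.

Lemma qopp_cls m (x : Zp) : qopp (qcls (m, x)) = qcls (m, zopp x).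
Proof.
apply: qcls_eq; have := qrel_repr (m, x); case: (qrepr _) => n y; rewrite /qrel /= => E k.
have := E k; rewrite !zseqE !modzE !mulrN => E'.
by rewrite -modzNm E' modzNm.
Qed.

Lemma qmul_cls m n (x y : Zp) : qmul (qcls (m, x)) (qcls (n, y)) = qcls ((m + n)%N, zmul x y).
Proof.
apply: qcls_eq; have := qrel_repr (m, x); case: (qrepr _) => a r Ex.
have := qrel_repr (n, y); case: (qrepr _) => b s; move: Ex; rewrite /qrel /= => Ex Ey k.
have /eqP := Ex k; have /eqP := Ey k; rewrite !zseqE !modzMml !modzMmr !eqz_mod_dvd.
move=> E1 E2; apply/eqP; rewrite eqz_mod_dvd !expnD !PoszM.
rewrite [X in X \in _](_ : _ =
    ((p ^ n)%N%:Z * zseq s k) * ((p ^ m)%N%:Z * zseq r k - (p ^ a)%N%:Z * zseq x k)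
  + ((p ^ a)%N%:Z * zseq x k) * ((p ^ n)%N%:Z * zseq s k - (p ^ b)%N%:Z * zseq y k)); last by ring.
by rewrite rpredD// dvdz_mull.
Qed.

(** For [y] $=p^{-n}z$ the bound says that $p^n$ divides $p^mz$, and the quotient is the new
    numerator. *)
Lemma qcls_bound m (y : Qp) : qabs y <= p%:R ^+ m -> exists z, y = qcls (m, z).
Proof.
rewrite -(qrepr_cls y); case: (qrepr y) => n z; rewrite qabs_cls => h.
have : zseq (zmul (zpow p m) z) n = 0.
  apply/eqP; rewrite -zabs_le zabs_zpow_mul mulrC ler_pdivrMr//.
  by rewrite mulrC ler_pdivlMr// mulrC.
move=> /zpow_dvd[x E]; exists x; by apply: qcls_eq; rewrite /qrel /= E.
Qed.

Lemma qabs_cls_lt m (x : Zp) k :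
  qabs (qcls (m, x)) < p%:R ^+ m * (p%:R ^+ k)^-1 -> zseq x k = 0.
Proof. by move=> /ltW; rewrite qabs_cls_le => /eqP. Qed.

Lemma zsub_eq0 (x y : Zp) k : (zseq (zadd x (zopp y)) k == 0) = (zseq x k == zseq y k).
Proof.
rewrite !zseqE !modzE -[in RHS]zseq_mod -[in RHS](zseq_mod y) eqz_mod_dvd.
by apply/eqP/dvdz_mod0P.
Qed.

(* After rescaling [a], membership of [p^-m x] in a ball is a congruence condition on [x]. *)
Lemma qball_cls m (a : Qp) (r : rat) : 0 < r ->
  exists k, forall x y : Zp, zseq x k = zseq y k ->
    qball a r (qcls (m, x)) <-> qball a r (qcls (m, y)).
Proof.
move=> r0; rewrite -(qrepr_cls a); case: (qrepr a) => n u.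
have [k kP] := @zabs_le_ball (r / p%:R ^+ (m + n)) (divr_gt0 r0 (prX_gt0 _)).
have ballE x : qball (qcls (n, u)) r (qcls (m, x)) <->
    zseq (zmul (zpow p n) x) k = zseq (zmul (zpow p m) u) k.
  rewrite /qball /= -(qcls_zpow m n x) -(qcls_zpow n m u) (addnC n).
  rewrite qopp_cls qadd_cls qabs_cls mulrC -ler_pdivlMr// kP zsub_eq0.
  by split=> /eqP.
by exists k => x y xy; rewrite !ballE !zseqE xy.
Qed.

Lemma qball_cls_self m (u x : Zp) k :
  qball (qcls (m, u)) (p%:R ^+ m * (p%:R ^+ k)^-1) (qcls (m, x)) <-> zseq x k = zseq u k.
Proof.
by rewrite /qball /= qopp_cls qadd_cls qabs_cls_le zsub_eq0; split=> /eqP.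
Qed.

(** * The van der Put functions *)

Lemma zdigit_sum (x : Zp) M : (\sum_(k < M) zdigit x k * p ^ k)%N = `|zseq x M|%N.
Proof.
elim: M => [|M IH]; first by rewrite big_ord0 zseq0.
rewrite big_ord_recr/= IH /zdigit; apply/eqP; rewrite -eqz_nat PoszD PoszM.
have xM : zseq x M <= zseq x M.+1.
  by rewrite zseqP {2}(divz_eq (zseq x M.+1) (p ^ M)%N%:Z) lerDr mulr_ge0//
     divz_ge0 ?ltz_nat// zseq_ge0.
rewrite !gez0_abs ?zseq_ge0//; last by rewrite divz_ge0 ?ltz_nat// subr_ge0.
rewrite divzK; first by rewrite addrC subrK.
by rewrite -eqz_mod_dvd zseq_mod (zseq_modn x (leqnSn M)).
Qed.

(** Any [M] that yields [j] is at least the level of [j], and truncating at that level already gives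
    [j]; the residue modulo [p ^ n] contains all the digits involved. *)
Lemma vdp_leP n j (x : Zp) : (j < p ^ n)%N ->
  vdp_le j x <-> vdp_nat p j `|zseq x n|%N.
Proof.
move=> jn; have E k : (k <= n)%N -> (`|zseq x n| %% p ^ k)%N = `|zseq x k|%N.
  by move=> kn; rewrite -(zseq_modn x kn) -{2}(gez0_abs (zseq_ge0 x n)) modz_nat absz_nat.
rewrite /vdp_le /vdp_nat; have [->|j0] := posnP j; first by split=> // _; left.
have ln : (trunc_log p j < n)%N.
  by apply: level_lt => //; case: n jn {E} => //; rewrite expn0 ltnS leqNgt j0.
rewrite E//=; split=> [[j00|[M]]|/eqP xj]; first by rewrite j00 in j0.
  rewrite zdigit_sum => jM; apply/eqP.
  have lM : (trunc_log p j <= M)%N.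
    rewrite -ltnS; apply: level_lt => //.
    by rewrite jM -ltz_nat gez0_abs ?zseq_ge0// zseq_lt.
  rewrite -(zseq_modn x (n := M.+1) (k := (trunc_log p j).+1))//.
  rewrite -(gez0_abs (zseq_ge0 x M.+1)) -jM modz_nat absz_nat modn_small//.
  exact: lt_exp_level.
by right; exists (trunc_log p j); rewrite zdigit_sum.
Qed.

Lemma vdp_cls j (x : Zp) : vdp j x = qcls (0%N, zconst p (if pselect (vdp_le j x) then 1 else 0)).
Proof. by rewrite /vdp; case: pselect. Qed.

End PadicBasics.

(** * Laws and residues *)

Section LawExtension.
Context (R : realType) (d : measure_display) (T : measurableType d) (P : probability T R).
Variables (U : Type) (G : set (set U)) (m : nat).
Hypotheses (GI : setI_closed G) (GT : G setT).

Let event (f : 'I_m -> T -> U) (B : 'I_m -> set U) : set T := [set w | forall i, B i (f i w)].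

Lemma measurable_preimage_gen (h : T -> U) :
  (forall B, G B -> measurable (h @^-1` B)) ->
  forall B, <<s G >> B -> measurable (h @^-1` B).
Proof.
move=> mG; apply: smallest_sub => //; split.
- by rewrite preimage_set0.
- by move=> A mA; rewrite setTD preimage_setC; exact: measurableC.
- by move=> A mA; rewrite preimage_bigcup; exact: bigcup_measurable.
Qed.

Let measurable_event f B : (forall i C, G C -> measurable (f i @^-1` C)) ->
  (forall i, <<s G >> (B i)) -> measurable (event f B).
Proof.
move=> mf GB; rewrite (_ : event f B = \bigcap_(i in [set: 'I_m]) (f i @^-1` B i)).
  apply: fin_bigcap_measurable => [|i _]; first exact: finite_finset.
  by apply: measurable_preimage_gen => // C; exact: mf.
by apply/seteqP; split=> w /= h i; [move=> _; exact: h|exact: h].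
Qed.

(** Dynkin's argument one coordinate at a time, which needs only boxes and no product
    sigma-algebra. *)
Lemma law_extension (f g : 'I_m -> T -> U) :
  (forall i B, G B -> measurable (f i @^-1` B)) ->
  (forall i B, G B -> measurable (g i @^-1` B)) ->
  (forall B, (forall i, G (B i)) -> P (event f B) = P (event g B)) ->
  forall B, (forall i, <<s G >> (B i)) -> P (event f B) = P (event g B).
Proof.
move=> mf mg fgG B GB.
(* Coordinates below [k] are already arbitrary in the generated sigma-algebra; the others still lie
   in [G]. *)
suff H k : forall B, (forall i, <<s G >> (B i)) ->
    (forall i : 'I_m, (k <= i)%N -> G (B i)) -> P (event f B) = P (event g B).
  by apply: (H m) => // i; rewrite leqNgt ltn_ord.
elim: k => [|k IH] {}B {}GB GkB; first by apply: fgG => i; exact: GkB.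
have [mk|km] := leqP m k.
  by apply: IH => // i ki; have := leq_trans mk ki; rewrite leqNgt ltn_ord.
pose i0 := Ordinal km.
pose upd (C : set U) i := if i == i0 then C else B i.
pose E h C := event h (upd C).
have updE h C : E h C = event h (upd setT) `&` (h i0 @^-1` C).
  apply/seteqP; split=> w /=.
    move=> H; split=> [i|]; last by have := H i0; rewrite /upd eqxx.
    by have := H i; rewrite /upd; case: eqP.
  move=> [H Hi0] i; have := H i; rewrite /upd; case: eqP => // -> _; exact: Hi0.
have sT : <<s G >> setT by exact: sub_sigma_algebra.
have gupd C i : <<s G >> C -> <<s G >> (upd C i) by rewrite /upd; case: eqP.
(* Only coordinate [i0] varies; the good sets form a lambda-system containing the pi-system [G]. *)
pose H := [set C | <<s G >> C /\ P (E f C) = P (E g C)].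
suff : <<s G >> `<=` H.
  move=> /(_ _ (GB i0))[_]; rewrite /E (_ : upd (B i0) = B)//.
  by apply: funext => i; rewrite /upd; case: eqP => [->|].
have mE h C : (forall i B, G B -> measurable (h i @^-1` B)) -> <<s G >> C -> measurable (E h C).
  by move=> mh GC; apply: measurable_event => // i; exact: gupd.
have sub : G `<=` H.
  move=> C GC; have sC : <<s G >> C by exact: sub_sigma_algebra.
  split=> //.
  apply: IH => [i|i ki]; first exact: gupd.
  rewrite /upd; case: eqP => // /eqP; rewrite -val_eqE/= => iki0.
  by apply: GkB; rewrite ltn_neqAle eq_sym iki0.
have [_ _ sD sU] := @g_sigma_algebra_lambda_system _ G setT (fun _ _ => @subsetT _ _).
have lH : lambda_system setT H.
  split=> //.
  - exact: sub.
  - move=> C D DC [GC PC] [GD PD].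
    have GCD : <<s G >> (C `\` D) by exact: sD.
    split=> //.
    have ED h : E h (C `\` D) = E h C `\` E h D.
      rewrite !updE; apply/seteqP; split=> w /=; first by move=> [? []]; tauto.
      by move=> [[? ?] nD]; split=> //; split=> // hD; exact: nD.
    have ECD h : E h C `&` E h D = E h D.
      rewrite !updE; apply/setIidPr => w [? ?]; split=> //; exact: DC.
    have PCD h : (forall i B, G B -> measurable (h i @^-1` B)) ->
        P (E h (C `\` D)) = (P (E h C) - P (E h D))%E.
      move=> mh; rewrite ED measureD ?ECD//; try exact: mE.
      by rewrite ltey_eq fin_num_measure//; exact: mE.
    by rewrite !PCD// PC PD.
  - move=> F ndF HF.
    have GF : <<s G >> (\bigcup_i F i) by apply: sU => // i; have [] := HF i.
    split=> //.
    have EF h : E h (\bigcup_i F i) = \bigcup_i E h (F i).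
      rewrite updE preimage_bigcup setI_bigcupr.
      by apply: eq_bigcupr => i _; rewrite updE.
    have cv h : (forall i B, G B -> measurable (h i @^-1` B)) ->
        P (E h (F i)) @[i --> \oo] --> P (E h (\bigcup_i F i)).
      move=> mh; rewrite EF; apply: nondecreasing_cvg_mu.
      + by move=> i; apply: mE => //; have [] := HF i.
      + by rewrite -EF; exact: mE.
      + move=> i j ij; apply/subsetPset; rewrite !updE => w [? ?]; split=> //.
        by have /subsetPset := ndF _ _ ij; apply.
    have := cv g mg; rewrite (_ : (fun i => P (E g (F i))) = (fun i => P (E f (F i)))).
      by move=> cg; apply: cvg_unique (cv f mf) cg => //; exact: ereal_hausdorff.
    by apply: funext => i; have [_ ->] := HF i.
exact: lambda_system_subset.
Qed.
End LawExtension.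

(** * Uniformity of the residue vector *)

Section ResidueVector.
Context (R : realType) (d : measure_display) (T : measurableType d) (P : probability T R).
Variables (p : nat) (Z : nat -> T -> Zpadic p) (N K : nat).
Hypotheses (p_gt1 : (1 < p)%N) (K_gt0 : (0 < K)%N).
Hypotheses (mZ : forall n, Zp_random_variable (Z n))
  (uZ : forall n, Zp_uniform P (Z n)) (iZ : Zp_independent P Z).

Let q_gt1 : (1 < p ^ K)%N. Proof. by rewrite -(expn0 p) ltn_exp2l. Qed.

Definition residues (w : T) : 'rV['Z_(p ^ K)]_N := \row_j (zseq (Z j w) K)%:~R.

Lemma zseq_zball (z : Zpadic p) (c : 'Z_(p ^ K)) :
  (zseq z K)%:~R = c <-> zball (zconst p (c : nat)%:Z) K z.
Proof.
have -> : zball (zconst p (c : nat)%:Z) K z <->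
    modz (zseq z K) (p ^ K)%N%:Z = modz (c : nat)%:Z (p ^ K)%N%:Z by rewrite zseq_mod.
rewrite -{1}(natr_Zp c) -[c%:R]/((c : nat)%:Z%:~R).
by split=> /eqP; [rewrite eq_intr_Zp// => /eqP|rewrite -eq_intr_Zp// => /eqP].
Qed.

(** Independence is stated for families indexed by [nat], hence the default centre 0 beyond [N]. *)
Let residue_ball (v : 'rV['Z_(p ^ K)]_N) (i : nat) : set (Zpadic p) :=
  zball (zconst p (oapp (fun j : 'I_N => (v 0 j : nat)) 0%N (insub i))%:Z) K.

Let residues_fiber v : [set w | residues w = v] =
  \bigcap_(i in [set` iota 0 N]) (Z i @^-1` residue_ball v i).
Proof.
apply/seteqP; split=> w /= => [<- i|h].
  rewrite /= mem_iota add0n /= => iN; rewrite /residue_ball (insubT (fun i => i < N)%N iN)/=.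
  by apply/zseq_zball; rewrite mxE.
apply/rowP => j; rewrite mxE; apply/zseq_zball.
have := h j; rewrite /= mem_iota add0n ltn_ord => /(_ isT).
by rewrite /residue_ball valK.
Qed.

Let residue_ball_borel v i : Zp_borel (residue_ball v i).
Proof. by apply: sub_sigma_algebra; eexists; eexists. Qed.

Let measurable_residues_fiber v : measurable [set w | residues w = v].
Proof.
rewrite residues_fiber; apply: fin_bigcap_measurable => [|i _]; first exact: finite_seq.
exact: mZ.
Qed.

Let prob_residues_fiber v :
  P [set w | residues w = v] = ((((p ^ K)%N%:R : R) ^+ N)^-1)%:E.
Proof.
rewrite residues_fiber iZ ?iota_uniq//; congr _%:E.
under eq_bigr do rewrite uZ /= -natrX.
have -> : iota 0 N = index_iota 0 N by rewrite /index_iota subn0.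
by rewrite prodr_const_nat subn0 exprVn.
Qed.

Let residues_event (F : pred 'rV['Z_(p ^ K)]_N) :
  [set w | F (residues w)] = \bigcup_(v in [set` enum F]) [set w | residues w = v].
Proof.
apply/seteqP; split=> w /=; first by exists (residues w) => //=; rewrite mem_enum.
by move=> [v /=]; rewrite mem_enum => Fv ->.
Qed.

Lemma measurable_residues (F : pred 'rV['Z_(p ^ K)]_N) : measurable [set w | F (residues w)].
Proof.
rewrite residues_event; apply: fin_bigcup_measurable.
  exact: finite_seq.
by move=> v _; exact: measurable_residues_fiber.
Qed.

(** Fixing a residue vector fixes a ball for each [Z j], so independence and Haar measure give every
    vector the same probability. *)
Lemma prob_residues (F : pred 'rV['Z_(p ^ K)]_N) :
  P [set w | F (residues w)] = (#|F|%:R / ((p ^ K)%N%:R : R) ^+ N)%:E.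
Proof.
rewrite residues_event measure_fin_bigcup; last 3 first.
- exact: finite_seq.
- by move=> u v _ _ [w /= [-> <-]].
- by move=> v _; exact: measurable_residues_fiber.
rewrite (eq_fsbigr (fun=> ((((p ^ K)%N%:R : R) ^+ N)^-1)%:E)); last first.
  by move=> v _; exact: prob_residues_fiber.
rewrite -fsbig_seq ?enum_uniq//= big_enum/= sumEFin sumr_const.
by rewrite mulr_natl.
Qed.
End ResidueVector.

(** * Reduction to integral coefficients and finite sums *)

Section Scaling.
Variable p : nat.
Hypothesis p_gt1 : (1 < p)%N.
Local Notation Zp := (Zpadic p).
Local Notation Qp := (Qpadic p).

(** All but finitely many coefficients lie in $\mathbb{Z}_p$; [m] is the largest denominator
    exponent among the rest. *)
Lemma qnull_scale (a : nat -> Qp) : qnull a -> exists m A, forall n, a n = qcls (m, A n).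
Proof.
move=> a0; have [N aN] := a0 1 ltr01.
pose m := (\max_(n < N) (qrepr (a n)).1)%N.
have p1 : 1 < p%:R :> rat by rewrite ltr1n.
have am n : qabs (a n) <= p%:R ^+ m.
  have [nN|Nn] := ltnP n N; last by rewrite (le_trans (ltW (aN _ Nn)))// exprn_ege1// ltW.
  rewrite /qabs; apply: (@le_trans _ _ (p%:R ^+ (qrepr (a n)).1)).
    rewrite ler_piMr ?exprn_ge0//.
    by have := zabs_le p_gt1 (qrepr (a n)).2 0; rewrite expr0 invr1 zseq0// eqxx.
  by rewrite ler_eXn2l//; exact: (leq_bigmax (Ordinal nN)).
have ex n : exists z, a n = qcls (m, z) by exact: qcls_bound.
by have [A aA] := choice ex; exists m, A.
Qed.

Lemma qnull_zseq (a : nat -> Qp) m A K : qnull a -> (forall n, a n = qcls (m, A n)) ->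
  exists n, forall j, (p ^ n <= j)%N -> zseq (A j) K = 0.
Proof.
move=> a0 aA; have pr0 k : 0 < p%:R ^+ k :> rat by rewrite exprn_gt0// ltr0n ltnW.
have [N aN] := a0 (p%:R ^+ m * (p%:R ^+ K)^-1) (divr_gt0 (pr0 m) (pr0 K)).
exists N => j Nj; have := aN j; rewrite aA => /(_ _)/qabs_cls_lt; apply => //.
by apply: leq_trans Nj; rewrite ltnW// ltn_expl.
Qed.

Lemma qseries_scale m (u : nat -> Zp) L : qseries_to (fun n => qcls (m, u n)) L ->
  exists2 y, L = qcls (m, y) & forall K N, (forall j, (N <= j)%N -> zseq (u j) K = 0) ->
    zseq y K = modz (\sum_(j < N) zseq (u j) K) (p ^ K)%N%:Z.
Proof.
move=> uL; have pr0 k : 0 < p%:R ^+ k :> rat by rewrite exprn_gt0// ltr0n ltnW.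
have S M : exists2 z, qsum (fun n => qcls (m, u n)) M = qcls (m, z) &
    forall K, zseq z K = modz (\sum_(j < M) zseq (u j) K) (p ^ K)%N%:Z.
  elim: M => [|M [z /= -> zS]].
    exists (zconst p 0) => [|K]; last by rewrite big_ord0.
    rewrite /= /qzero /Zp_to_Qp -(qcls_zpow p_gt1 0 m) add0n.
    congr (qcls (m, _)); apply: zeqv_eq => k.
    by rewrite zseq_zmul zseq_zconst0 mulr0 mod0z.
  exists (zadd z (u M)) => [|K]; first by rewrite qadd_cls.
  by rewrite zseq_zadd zS modzDml big_ord_recr.
(* Some partial sum in $p^{-m}\mathbb{Z}_p$ is within $p^m$ of [L], so the ultrametric inequality
   puts [L] there too. *)
have [y Ly] : exists y, L = qcls (m, y).
  have [N uN] := uL (p%:R ^+ m) (pr0 m).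
  have [z Sz _] := S N; have := uN N (leqnn N); rewrite Sz.
  rewrite -(qrepr_cls L); case: (qrepr L) => n y.
  rewrite -(qcls_zpow p_gt1 m n z) -{1}(qcls_zpow p_gt1 n m y) (addnC n).
  rewrite qopp_cls// qadd_cls// => h.
  have : zseq (zmul (zpow p m) y) n = 0.
    have /eqP : zseq (zadd (zmul (zpow p n) z) (zopp (zmul (zpow p m) y))) n = 0.
      apply: (qabs_cls_lt p_gt1 (m := (m + n)%N)).
      by rewrite exprD mulfK ?lt0r_neq0.
    rewrite zsub_eq0// => /eqP <-.
    by rewrite -[X in zseq _ X]addn0 zseq_zpow_mul// zseq0// mulr0.
  move=> /(zpow_dvd p_gt1)[x E]; exists x; apply: qcls_eq => //.
  by rewrite /qrel /= E.
exists y => // K N u0.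
(* At distance below $p^{m-K}$ the numerators agree modulo [p ^ K], and terms from [N] on contribute
   nothing. *)
have [N' uN'] := uL (p%:R ^+ m * (p%:R ^+ K)^-1) (divr_gt0 (pr0 m) (pr0 K)).
have [z Sz zS] := S (maxn N N'); have := uN' _ (leq_maxr N N').
rewrite Sz Ly qopp_cls// qadd_cls// => /(qabs_cls_lt p_gt1)/eqP.
rewrite zsub_eq0// => /eqP <-; rewrite zS.
congr modz; rewrite -!(big_mkord xpredT (fun j => zseq (u j) K)).
rewrite (big_cat_nat _ (leq_maxl N N'))//= [X in _ + X]big1_seq ?addr0// => j.
by rewrite mem_index_iota => /andP[_ /andP[Nj _]]; exact: u0.
Qed.

End Scaling.

Definition extend_row (N : nat) (A : zmodType) (v : 'rV[A]_N) (j : nat) : A :=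
  oapp (v 0) 0 (insub j).

Lemma vdp_sum_extend_row (p N : nat) (A : comPzRingType) (al ze : nat -> A) x :
  vdp_sum p N al (extend_row (\row_(j < N) ze j)) x = vdp_sum p N al ze x.
Proof.
by rewrite /vdp_sum; apply: eq_bigr => j _; rewrite /extend_row valK /= mxE.
Qed.

Definition vdp_eval (p N : nat) (A : comPzRingType) (al : nat -> A) (r : nat)
  (xs : 'I_r -> nat) (v : 'rV[A]_N) : 'rV[A]_r :=
  \row_i vdp_sum p N al (extend_row v) (xs i).

Lemma vdp_evalD p N (A : comPzRingType) (al : nat -> A) r (xs : 'I_r -> nat) :
  {morph vdp_eval (N := N) p al xs : u v / u + v}.
Proof.
move=> u v; apply/rowP => i; rewrite !mxE /vdp_sum -big_split/=; apply: eq_bigr => j _.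
by rewrite /extend_row valK /= mxE mulrDr.
Qed.

(** * Stationarity *)

Section Law.
Context (R : realType) (d : measure_display) (T : measurableType d) (P : probability T R).
Variables (p : nat) (a : nat -> Qpadic p) (Z : nat -> T -> Zpadic p)
  (X : T -> Zpadic p -> Qpadic p) (m : nat) (A : nat -> Zpadic p).
Hypotheses (pp : prime p) (a0 : qnull a) (aA : forall n, a n = qcls (m, A n)).
Hypotheses (mZ : forall n, Zp_random_variable (Z n))
  (uZ : forall n, Zp_uniform P (Z n)) (iZ : Zp_independent P Z).
Hypothesis XS : forall w x, qseries_to
  (fun n => qmul (a n) (qmul (Zp_to_Qp (Z n w)) (vdp n x))) (X w x).

Let p_gt1 : (1 < p)%N. Proof. exact: prime_gt1. Qed.

Section Level.
Variables (K n : nat).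
Hypothesis K_gt0 : (0 < K)%N.
Hypothesis A0 : forall j, (p ^ n <= j)%N -> zseq (A j) K = 0.
Local Notation N := (p ^ n)%N.
Local Notation Zq := ('Z_(p ^ K)).

Let q_gt1 : (1 < p ^ K)%N. Proof. by rewrite -(expn0 p) ltn_exp2l. Qed.

Let al (j : nat) : Zq := (zseq (A j) K)%:~R.

Lemma intr_modz (b : int) : (modz b (p ^ K)%N%:Z)%:~R = b%:~R :> Zq.
Proof. by apply/eqP; rewrite eq_intr_Zp// modz_mod. Qed.

Lemma X_residue w x : exists2 y, X w x = qcls (m, y) &
  (zseq y K)%:~R = vdp_sum p N al (extend_row (residues Z N K w)) `|zseq x n|%N.
Proof.
pose u j := zmul (A j) (zmul (Z j w) (zconst p (if pselect (vdp_le j x) then 1 else 0))).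
have : qseries_to (fun j => qcls (m, u j)) (X w x).
  have := XS w x; rewrite (_ : (fun _ => qmul _ _) = fun j => qcls (m, u j))//.
  by apply: funext => j; rewrite aA vdp_cls /Zp_to_Qp !qmul_cls// !addn0.
move=> /(qseries_scale p_gt1)[y Xy yS]; exists y => //.
rewrite (yS K N); last by move=> j Nj; rewrite /u zseq_zmul A0// mul0r mod0z.
rewrite intr_modz rmorph_sum (vdp_sum_extend_row p N al (fun j => (zseq (Z j w) K)%:~R))
  /vdp_sum [RHS]big_mkcond.
apply: eq_bigr => j _; rewrite -[LHS]/((zseq (u j) K)%:~R) /u !zseq_zmul.
rewrite !intr_modz rmorphM/= intr_modz rmorphM/=.
rewrite -/(al j) mulrA /zmk_seq intr_modz; have := vdp_leP p_gt1 x (ltn_ord j).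
case: pselect => [h [/(_ h) -> _]|h [_ h']]; first by rewrite mulr1.
by rewrite mulr0 ifN//; apply/negP => /h'.
Qed.

Lemma X_event x (B : set (Qpadic p)) (b : pred Zq) :
  (forall y, B (qcls (m, y)) <-> b (zseq y K)%:~R) -> forall w,
  B (X w x) <-> b (vdp_sum p N al (extend_row (residues Z N K w)) `|zseq x n|%N).
Proof. by move=> Bb w; have [y -> <-] := X_residue w x. Qed.

(** The event depends only on the uniform residue vector, so its probability is a proportion of
    vectors. *)
Lemma X_prob r (xs : 'I_r -> Zpadic p) (B : 'I_r -> set (Qpadic p)) (b : 'I_r -> pred Zq) :
  (forall i y, B i (qcls (m, y)) <-> b i (zseq y K)%:~R) ->
  P [set w | forall i, B i (X w (xs i))] =
  (#|[pred v | [forall i, b i (vdp_eval (N := N) p al (fun i => `|zseq (xs i) n|%N) v 0 i)]]|%:R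
   / ((p ^ K)%N%:R : R) ^+ N)%:E.
Proof.
move=> Bb; rewrite -(prob_residues p_gt1 K_gt0 mZ uZ iZ); congr (P _).
apply/seteqP; split=> w /=.
  by move=> h; apply/forallP => i; rewrite mxE; apply/(X_event _ (Bb i))/h.
by move=> /forallP h i; apply/(X_event _ (Bb i)); have := h i; rewrite mxE.
Qed.

Lemma zseq_zadd_mod (x s : Zpadic p) :
  (`|zseq (zadd x s) n| = `|zseq x n| + `|zseq s n| %[mod p ^ n])%N.
Proof.
have E : zseq (zadd x s) n = ((`|zseq x n| + `|zseq s n|) %% p ^ n)%N%:Z.
  by rewrite zseq_zadd -modz_nat PoszD !gez0_abs ?zseq_ge0.
by rewrite E absz_nat modn_mod.
Qed.

(** Evaluations at the points and at their translates have the same image by [vdp_sum_shift], so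
    [card_preim_morph] applies. *)
Lemma vdp_eval_shift_card r (xs : 'I_r -> Zpadic p) s (F : pred 'rV[Zq]_r) :
  (forall i j, (i < N)%N -> (p ^ trunc_log p i <= j < N)%N -> exists c, al j = c * al i) ->
  #|[pred v | F (vdp_eval (N := N) p al (fun i => `|zseq (zadd (xs i) s) n|%N) v)]| =
  #|[pred v | F (vdp_eval (N := N) p al (fun i => `|zseq (xs i) n|%N) v)]|.
Proof.
move=> dv; apply: card_preim_morph; try exact: vdp_evalD.
- move=> v; have [ze zeP] := vdp_sum_shift p_gt1 dv (extend_row v) `|zseq s n|%N.
  exists (\row_j ze j); apply/rowP => i; rewrite !mxE vdp_sum_extend_row zeP.
  by apply: vdp_sum_mod => //; rewrite zseq_zadd_mod.
(* Adding [p ^ n] minus the residue of [s] undoes the translation modulo [p ^ n]. *)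
- move=> v; have [ze zeP] := vdp_sum_shift p_gt1 dv (extend_row v) (p ^ n - `|zseq s n|)%N.
  exists (\row_j ze j); apply/rowP => i; rewrite !mxE vdp_sum_extend_row zeP.
  apply: vdp_sum_mod => //; rewrite -modnDml zseq_zadd_mod modnDml -addnA subnKC ?modnDr//.
  by rewrite ltnW// -ltz_nat gez0_abs ?zseq_ge0// zseq_lt.
Qed.

End Level.

(** A pi-system containing all balls of positive radius. Only the trace on $p^{-m}\mathbb{Z}_p$ is
    constrained, because [X] takes its values there. *)
Definition residual_sets : set (set (Qpadic p)) :=
  [set B | exists K, forall x y, zseq x K = zseq y K ->
    (B (qcls (m, x)) <-> B (qcls (m, y)))].

Lemma residual_setsI : setI_closed residual_sets.
Proof.
move=> B C [K BK] [L CL]; exists (maxn K L) => x y xy.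
have xyK := zseq_eq_le p_gt1 (leq_maxl K L) xy.
have xyL := zseq_eq_le p_gt1 (leq_maxr K L) xy.
by have := BK _ _ xyK; have := CL _ _ xyL; rewrite /setI /=; tauto.
Qed.

(** Raising the precision lets finitely many sets share one [K]. Positivity of [K] matters, since
    ['Z_1] is by convention $\mathbb{Z}/2$. *)
Lemma residual_sets_pred (B : set (Qpadic p)) K K' :
  (forall x y, zseq x K' = zseq y K' -> (B (qcls (m, x)) <-> B (qcls (m, y)))) ->
  (K' <= K)%N -> (0 < K)%N ->
  exists b : pred 'Z_(p ^ K), forall y, B (qcls (m, y)) <-> b (zseq y K)%:~R.
Proof.
move=> BK' K'K K0.
exists (fun c => `[< B (qcls (m, zconst p (c : nat)%:Z)) >]) => y.
have [+ _] := zseq_zball p_gt1 K0 y (zseq y K)%:~R.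
move=> /(_ erefl) /(zseq_eq_le p_gt1 K'K)/BK' ->.
by split=> /asboolP.
Qed.

Lemma measurable_residual x B : residual_sets B -> measurable ((fun w => X w x) @^-1` B).
Proof.
move=> [K' BK']; have [b bP] := residual_sets_pred BK' (leqnSn K') (ltn0Sn K').
have [n A0] := qnull_zseq p_gt1 K'.+1 a0 aA.
rewrite (_ : _ @^-1` B = [set w | b (vdp_sum p (p ^ n) (fun j => (zseq (A j) K'.+1)%:~R)
  (extend_row (residues Z (p ^ n) K'.+1 w)) `|zseq x n|%N)]).
  exact: (measurable_residues p_gt1 (ltn0Sn K') mZ
    (fun v => b (vdp_sum p (p ^ n) (fun j => (zseq (A j) K'.+1)%:~R)
      (extend_row v) `|zseq x n|%N))).
by apply/seteqP; split=> w /=; have /(_ w)[] := X_event (ltn0Sn K') A0 x bP.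
Qed.

(** Absolute values are constant on levels and decrease along powers of [p]. For [i = 0], whose
    level is also 0, the chain ends with the step from index 1 to index 0. *)
Lemma qabs_le_level :
  qabs (a 1%N) <= qabs (a 0%N) ->
  (forall n : nat, qabs (a (p ^ n.+1)%N) <= qabs (a (p ^ n)%N)) ->
  (forall n j : nat, (p ^ n <= j < p ^ n.+1)%N -> qabs (a j) = qabs (a (p ^ n)%N)) ->
  forall i j, (p ^ trunc_log p i <= j)%N -> qabs (a j) <= qabs (a i).
Proof.
move=> a10 amono alev i j ij.
have j0 : (0 < j)%N by apply: leq_trans ij; rewrite expn_gt0 ltnW.
have lev k : (0 < k)%N -> qabs (a k) = qabs (a (p ^ trunc_log p k)%N).
  by move=> k0; apply: alev; exact: trunc_log_bounds.
have mono k l : (k <= l)%N -> qabs (a (p ^ l)%N) <= qabs (a (p ^ k)%N).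
  elim: l => [|l IH]; first by rewrite leqn0 => /eqP->.
  by rewrite leq_eqVlt => /predU1P[->//|/IH]; exact: le_trans.
rewrite (lev j j0); have [->|i0] := posnP i.
  by apply: le_trans a10; have := mono 0%N (trunc_log p j) (leq0n _); rewrite expn0.
by rewrite (lev i i0); apply: mono; apply: trunc_log_max.
Qed.

Lemma stationary_of_qabs :
  (forall i j, (p ^ trunc_log p i <= j)%N -> qabs (a j) <= qabs (a i)) ->
  stationary P X.
Proof.
move=> amono s r xs B BB.
apply: (@law_extension _ _ _ P _ residual_sets r residual_setsI _
  (fun i w => X w (zadd (xs i) s)) (fun i w => X w (xs i))).
- by exists 0%N.
- by move=> i C; exact: measurable_residual.
- by move=> i C; exact: measurable_residual.
- move=> {BB}B GB; have [k kP] := choice GB.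
  (* One positive precision that serves all the sets [B i]. *)
  pose K := (\max_(i < r) k i).+1.
  have [b bP] := choice (fun i =>
    residual_sets_pred (kP i) (leqW (leq_bigmax i)) (ltn0Sn _ : (0 < K)%N)).
  have [n A0] := qnull_zseq p_gt1 K a0 aA.
  rewrite !(X_prob (ltn0Sn _ : (0 < K)%N) A0 _ bP); congr (_%:R / _)%:E.
  apply: (vdp_eval_shift_card (K := K) xs s (fun u => [forall i, b i (u 0 i)])).
  move=> i j iN /andP[ij _].
  apply: intr_Zp_dvd => // l lK; rewrite !zseq_dvd// => /eqP Ai.
  by apply/eqP; have := amono _ _ ij; rewrite !aA qabs_cls_le_cls//; exact.
- move=> i; apply: sub_sigma_algebra2 (BB i) => _ [c [rho [rho0 ->]]].
  exact: qball_cls.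
Qed.

(** * From stationarity to equality of images *)

Section Necessity.
Hypothesis stX : stationary P X.
Variables (K n : nat).
Hypothesis K_gt0 : (0 < K)%N.
Hypothesis A0 : forall j, (p ^ n <= j)%N -> zseq (A j) K = 0.
Local Notation N := (p ^ n)%N.
Local Notation Zq := ('Z_(p ^ K)).
Let al (j : nat) : Zq := (zseq (A j) K)%:~R.

Lemma stationary_eval_card r (xs : 'I_r -> Zpadic p) s (c : 'rV[Zq]_r) :
  #|[pred v | vdp_eval (N := N) p al (fun i => `|zseq (zadd (xs i) s) n|%N) v == c]| =
  #|[pred v | vdp_eval (N := N) p al (fun i => `|zseq (xs i) n|%N) v == c]|.
Proof.
have p0 : 0 < p%:R :> rat by rewrite ltr0n ltnW.
(* A ball of radius $p^{m-K}$ prescribes the residue [c 0 i] exactly, so equal probabilities become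
   equal fibre sizes. *)
pose B i := qball (qcls (m, zconst p (c 0 i : nat)%:Z)) (p%:R ^+ m * (p%:R ^+ K)^-1).
have BB i : Qp_borel (B i).
  apply: sub_sigma_algebra; eexists; eexists; split; last by [].
  by rewrite divr_gt0// exprn_gt0.
pose b i : pred Zq := pred1 (c 0 i).
have bP i y : B i (qcls (m, y)) <-> b i (zseq y K)%:~R.
  rewrite /B /b qball_cls_self//; have := zseq_zball p_gt1 K_gt0 y (c 0 i).
  by rewrite /zball /= => <-; split=> /eqP.
have : P [set w | forall i, B i (X w (zadd (xs i) s))] =
    P [set w | forall i, B i (X w (xs i))] by exact: stX.
rewrite (X_prob K_gt0 A0 (fun i => zadd (xs i) s) bP) (X_prob K_gt0 A0 xs bP) => -[] /mulIf.
have q0 : (p ^ K)%N%:R ^+ N != 0 :> R by rewrite expf_neq0// pnatr_eq0 -lt0n expn_gt0 ltnW.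
rewrite invr_eq0 => /(_ q0) /eqP; rewrite eqr_nat => /eqP.
have E (f : 'rV[Zq]_N -> 'rV[Zq]_r) :
    #|[pred v | f v == c]| = #|[pred v | [forall i, b i (f v 0 i)]]|.
  apply: eq_card => v; rewrite !inE; apply/eqP/forallP => [-> i|h]; first exact: eqxx.
  by apply/rowP => i; apply/eqP; exact: h.
by rewrite -!E.
Qed.

Lemma stationary_shift_pair x y s ze :
  (exists ze', vdp_sum p N al ze' x = vdp_sum p N al ze (x + s)%N /\
     vdp_sum p N al ze' y = vdp_sum p N al ze (y + s)%N) /\
  (exists ze', vdp_sum p N al ze' (x + s)%N = vdp_sum p N al ze x /\
     vdp_sum p N al ze' (y + s)%N = vdp_sum p N al ze y).
Proof.
pose xs (i : 'I_2) := zconst p (if i == 0 then x else y)%:Z.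
have zc (t : nat) : (`|zseq (zconst p t%:Z) n| = t %[mod N])%N.
  by rewrite -[zseq _ _]/(modz _ _) modz_nat absz_nat modn_mod.
have zcs (t : nat) : (`|zseq (zadd (zconst p t%:Z) (zconst p s%:Z)) n| = t + s %[mod N])%N.
  by rewrite zseq_zadd_mod -modnDm !zc modnDm.
have ev (ys : 'I_2 -> nat) (f : nat -> Zq) : vdp_eval (N := N) p al ys (\row_j f j) =
    \row_i vdp_sum p N al f (ys i).
  by apply/rowP => i; rewrite !mxE vdp_sum_extend_row.
have ex (ys ys' : 'I_2 -> nat) :
    (forall c, #|[pred v | vdp_eval (N := N) p al ys v == c]| =
       #|[pred v | vdp_eval (N := N) p al ys' v == c]|) ->
    exists ze', forall i, vdp_sum p N al ze' (ys' i) = vdp_sum p N al ze (ys i).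
  (* The fibre over [c] is nonempty on one side, hence on the other, where any element gives
     [ze']. *)
  pose c := vdp_eval (N := N) p al ys (\row_j ze j).
  move=> h; have : (0 < #|[pred v | vdp_eval (N := N) p al ys' v == c]|)%N.
    by rewrite -h; apply/card_gt0P; exists (\row_j ze j); rewrite inE.
  move=> /card_gt0P[v]; rewrite inE => /eqP Ev; exists (extend_row v) => i.
  by have := congr1 (fun M : 'rV_2 => M 0 i) Ev; rewrite /c ev !mxE.
have st := stationary_eval_card xs (zconst p s%:Z).
split.
  have [ze' h] := ex _ _ st; exists ze'.
  by split; [have := h 0|have := h 1]; rewrite /xs /= (vdp_sum_mod p_gt1 _ _ (zc _))
    (vdp_sum_mod p_gt1 _ _ (zcs _)).
have [ze' h] := ex _ _ (fun c => esym (st c)); exists ze'.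
by split; [have := h 0|have := h 1]; rewrite /xs /= (vdp_sum_mod p_gt1 _ _ (zc _))
  (vdp_sum_mod p_gt1 _ _ (zcs _)).
Qed.

End Necessity.

(** An inequality of absolute values says that each power of [p] dividing [A i] divides [A j], and
    this can be read modulo that power. *)
Lemma qabs_le_of_dvd i j :
  (forall K n, (0 < K)%N -> (forall j, (p ^ n <= j)%N -> zseq (A j) K = 0) ->
     (i < p ^ n)%N -> (j < p ^ n)%N ->
     exists u, (zseq (A j) K)%:~R = (zseq (A i) K)%:~R * u :> 'Z_(p ^ K)) ->
  qabs (a j) <= qabs (a i).
Proof.
move=> h; rewrite !aA qabs_cls_le_cls// => -[|K] AiK; first by rewrite zseq0.
have [n A0] := qnull_zseq p_gt1 K.+1 a0 aA.
pose l := maxn n (maxn i j).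
have A0' k : (p ^ l <= k)%N -> zseq (A k) K.+1 = 0.
  by move=> lk; apply: A0; apply: leq_trans lk; rewrite leq_exp2l// leq_maxl.
have il : (i < p ^ l)%N.
  by apply: leq_trans (ltn_expl _ p_gt1) _; rewrite leq_exp2l// /l; lia.
have jl : (j < p ^ l)%N.
  by apply: leq_trans (ltn_expl _ p_gt1) _; rewrite leq_exp2l// /l; lia.
have [u] := h _ _ (ltn0Sn K) A0' il jl.
rewrite AiK mul0r => /eqP; rewrite intr_Zp_eq0 ?zseq_dvd//; first by move=> /eqP.
by rewrite -(expn0 p) ltn_exp2l.
Qed.

Lemma stationary_qabs : stationary P X ->
  [/\ qabs (a 1%N) <= qabs (a 0%N),
      (forall n : nat, qabs (a (p ^ n.+1)%N) <= qabs (a (p ^ n)%N)) &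
      (forall n j : nat, (p ^ n <= j < p ^ n.+1)%N -> qabs (a j) = qabs (a (p ^ n)%N))].
Proof.
move=> stX.
(* This yields both the decrease along powers of [p] and half of the equality within a level. *)
have up k j : (p ^ k <= j)%N -> qabs (a j) <= qabs (a (p ^ k)%N).
  move=> kj; apply: qabs_le_of_dvd => // K n K0 A0 _ jn.
  have := shift_dvd_al_up p_gt1 (stationary_shift_pair stX K0 A0) (k := k) (j := j).
  by rewrite kj jn => /(_ isT).
split.
- apply: qabs_le_of_dvd => // K n K0 A0 _.
  exact: (shift_dvd_al01 p_gt1 (stationary_shift_pair stX K0 A0)).
- by move=> n; apply: up; rewrite leq_exp2l.
- move=> k j /[dup] kj /andP[pkj _]; apply/eqP; rewrite eq_le up//=.
  apply: qabs_le_of_dvd => // K n K0 A0 jn _.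
  exact: (shift_dvd_al_down p_gt1 (stationary_shift_pair stX K0 A0) kj jn).
Qed.

End Law.

Theorem theorem8p3 (p : nat) (R : realType) (d : measure_display)
  (T : measurableType d) (P : probability T R)
  (a : nat -> Qpadic p) (Z : nat -> T -> Zpadic p) (X : T -> Zpadic p -> Qpadic p) :
  prime p ->
  qnull a ->
  (forall n, Zp_random_variable (Z n)) ->
  (forall n, Zp_uniform P (Z n)) ->
  Zp_independent P Z ->
  (forall w x, qseries_to
     (fun n => qmul (a n) (qmul (Zp_to_Qp (Z n w)) (vdp n x))) (X w x)) ->
  (stationary P X <->
   [/\ qabs (a 1%N) <= qabs (a 0%N),
       (forall n : nat, qabs (a (p ^ n.+1)%N) <= qabs (a (p ^ n)%N)) &
       (forall n j : nat, (p ^ n <= j < p ^ n.+1)%N ->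
          qabs (a j) = qabs (a (p ^ n)%N))]).
Proof.
move=> pp a0 mZ uZ iZ XS.
have [m [A aA]] := qnull_scale (prime_gt1 pp) a0.
split; first exact: (stationary_qabs pp a0 aA mZ uZ iZ XS).
by move=> [a10 amono alev];
  apply: (stationary_of_qabs pp a0 aA mZ uZ iZ XS); exact: (qabs_le_level pp).
Qed.
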